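(* Let $d\ge 2$ and $n,k\ge 0$ be integers. Then $N_d(n,k)$ equals the number of trees in $\mathcal{T}_d$ with $(n-k)(d-1)+k+1$ edges and $k+1$ internal nodes.
   Context: $N_d(n,k) = \frac{1}{n+1} \binom{n+1}{k+1} \binom{ n + (n-k)(d-2)+1}{k}$. An ordered tree is a rooted unlabelled tree in which the children of each vertex are linearly ordered. The outdegree of a vertex is its number of children; leaves have outdegree $0$, internal nodes have positive outdegree. $\mathcal{T}_d$ is the set of ordered trees with at least one internal node in which the outdegree of every internal node is congruent to $1$ modulo $d-1$. *)

(* Defs.v *)
From mathcomp Require Import all_boot all_order all_algebra.
From mathcomp Require Import all_classical.

Set Implicit Arguments.
Unset Strict Implicit.
Unset Printing Implicit Defensive.

Import GRing.Theory.
Local Open Scope ring_scope.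

(* Binomial coefficient with an arbitrary integer upper argument: the upper
   argument of the second binomial in [Nd] is negative for some k > n. *)
Definition binz (x : int) (k : nat) : rat :=
  (\prod_(i < k) (x - i%:Z)%:~R) / (k`!)%:R.

Definition Nd (d n k : nat) : rat :=
  (n.+1)%:R^-1 * 'C(n.+1, k.+1)%:R
  * binz (n%:Z + (n%:Z - k%:Z) * (d%:Z - 2) + 1) k.

(* An ordered tree is the ordered sequence of the subtrees at its root's
   children; a leaf is [Node [::]]. *)
Inductive otree : Type := Node of seq otree.

Definition children (t : otree) : seq otree := let: Node s := t in s.

(* One entry per vertex of t, each vertex given by the subtree rooted at it. *)
Fixpoint vertices (t : otree) : seq otree :=
  let: Node s := t in t :: flatten (map vertices s).

Definition outdegree (v : otree) : nat := size (children v).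

Definition internal (v : otree) : bool := (0 < outdegree v)%N.

Definition num_internal (t : otree) : nat := count internal (vertices t).

Fixpoint num_edges (t : otree) : nat :=
  let: Node s := t in (size s + sumn (map num_edges s))%N.

Definition Td (d : nat) (t : otree) : bool :=
  has internal (vertices t) &&
  all (fun v => internal v ==> (outdegree v == 1 %[mod d - 1])%N) (vertices t).

(* Main.v *)
Require Import Defs.
From HB Require Import structures.
From mathcomp Require Import all_boot all_order all_algebra.
From mathcomp Require Import all_classical.
From mathcomp Require Import zify ring.

Import GRing.Theory.

(* Let D = d - 1 and count ordered forests with r trees and m internal nodes of
   outdegrees 1 + j D, the j's having sum s; such a forest has v = r + m + D s
   vertices. Deleting the first root and releasing its children gives
     F(r+1, m, s) = F(r, m, s) + sum_j F(r + 1 + j D, m - 1, s - j),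
   and all terms on the right have the same number v - 1 of vertices. Induction
   on v then yields v F(r, m, s) = r C(v, m) C(s + m - 1, s), because
   sum_j C(s - j + m - 2, s - j) and its first moment in j are again
   binomials. The theorem is the case r = 1, m = k + 1, s = n - k; there are no
   trees when k > n, since a tree has at least as many edges as internal
   nodes. *)

HB.instance Definition _ := gen_eqMixin otree.

(** * Ordered forests and removal of the first root *)

Definition forest_vertices (f : seq otree) : seq otree :=
  flatten (map vertices f).

Definition forest_internal (f : seq otree) : nat :=
  count internal (forest_vertices f).

Definition forest_edges (f : seq otree) : nat := sumn (map num_edges f).

Definition degree_ok (D : nat) (v : otree) : bool :=
  internal v ==> (outdegree v == 1 %[mod D]).

Definition forest_ok (D : nat) (f : seq otree) : bool :=
  all (degree_ok D) (forest_vertices f).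

Lemma forest_internal_Node c f :
  forest_internal (Node c :: f) = (0 < size c) + forest_internal (c ++ f).
Proof.
by rewrite /forest_internal /forest_vertices map_cat flatten_cat /= !count_cat.
Qed.

Lemma forest_edges_Node c f :
  forest_edges (Node c :: f) = size c + forest_edges (c ++ f).
Proof. by rewrite /forest_edges map_cat sumn_cat /= addnA. Qed.

Lemma forest_ok_Node D c f :
  forest_ok D (Node c :: f) =
  ((0 < size c) ==> (size c == 1 %[mod D])) && forest_ok D (c ++ f).
Proof.
by rewrite /forest_ok /forest_vertices map_cat flatten_cat /= !all_cat.
Qed.

(** Releasing the children of the first root lowers [size f + forest_edges f], the number of
    vertices, by exactly one. This replaces a nested induction on [otree]. *)
Lemma forest_ind (P : seq otree -> Prop) :
  P [::] -> (forall c f, P (c ++ f) -> P (Node c :: f)) -> forall f, P f.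
Proof.
move=> P0 PS f; have [v] := ubnP (size f + forest_edges f).
elim: v f => // v IH [//|[c] f]; rewrite forest_edges_Node /= => lt_v.
by apply/PS/IH; rewrite size_cat; lia.
Qed.

Lemma forest_internal_le_edges f : forest_internal f <= forest_edges f.
Proof.
elim/forest_ind: f => // c f IH.
by rewrite forest_internal_Node forest_edges_Node leq_add //; case: (size c).
Qed.

(** * Enumeration of forests by the first outdegree *)

Definition graft (a : nat) (f : seq otree) : seq otree :=
  Node (take a f) :: drop a f.

Lemma graft_size_cat c f : graft (size c) (c ++ f) = Node c :: f.
Proof. by rewrite /graft take_size_cat // drop_size_cat. Qed.

(** The bounds ensure that the new first root has exactly [a], respectively [b], children. *)
Lemma graft_inj a b f g :
  a <= size f -> b <= size g -> graft a f = graft b g -> a = b /\ f = g.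
Proof.
move=> af bg [eq_take eq_drop]; split.
  by rewrite -(size_takel af) eq_take size_takel.
by rewrite -(cat_take_drop a f) eq_take eq_drop cat_take_drop.
Qed.

(* Forests with [v] vertices, [r] trees and [m] internal nodes of outdegrees
   [1 + j * D] with the [j]s summing to [s], listed by the outdegree of the
   first vertex in preorder. Meaningful only for [v = r + m + D * s]. *)
Fixpoint forests (D v r m s : nat) : seq (seq otree) :=
  match v, r with
  | v'.+1, r'.+1 =>
    map (graft 0) (forests D v' r' m s) ++
    if m is m'.+1 then
      [seq graft (1 + j * D) f
         | j <- iota 0 s.+1, f <- forests D v' (r + j * D) m' (s - j)]
    else [::]
  | 0, 0 => [:: [::]]
  | _, _ => [::]
  end.

Lemma forestsS D v r m s :
  forests D v.+1 r.+1 m s =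
  map (graft 0) (forests D v r m s) ++
  if m is m'.+1 then
    [seq graft (1 + j * D) f
       | j <- iota 0 s.+1, f <- forests D v (r.+1 + j * D) m' (s - j)]
  else [::].
Proof. by []. Qed.

(** The sum [s] of the [j]s is read off the edges: [m] internal nodes of outdegrees [1 + j * D] have
    [m + D * s] edges in all. *)
Lemma mem_forests D v r m s (f : seq otree) : 0 < D -> v = r + m + D * s ->
  (f \in forests D v r m s) =
  [&& size f == r, forest_ok D f, forest_internal f == m
    & forest_edges f == m + D * s].
Proof.
move=> D0; elim: v r m s f => [|v IH] r m s f.
  move=> v0; have [-> -> s0] : [/\ r = 0, m = 0 & s = 0] by split; nia.
  by rewrite s0 muln0 /= inE; case: f.
case: r => [|r] vE.
  case: f => [|t f] //; rewrite /forest_internal /forest_edges /=.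
  by symmetry; apply/negbTE; lia.
apply/idP/idP.
  rewrite forestsS mem_cat => /orP[/mapP[g]|].
    rewrite IH; last by lia.
    case/and4P=> /eqP sg okg ig eg ->; rewrite /graft take0 drop0.
    rewrite forest_ok_Node forest_internal_Node forest_edges_Node /=.
    by rewrite sg okg !add0n ig eg eqxx.
  case: m vE => // m vE /allpairsPdep[j [g [js]]].
  move: js; rewrite mem_iota => js; rewrite IH; last by nia.
  case/and4P=> /eqP sg okg /eqP ig /eqP eg ->.
  have le_j : 1 + j * D <= size g by rewrite sg; lia.
  rewrite /graft forest_ok_Node forest_internal_Node forest_edges_Node.
  rewrite cat_take_drop (size_takel le_j) /= okg ig eg size_drop sg.
  rewrite [1 + _]addnC modnMDl eqxx /=; apply/and3P; split => //; apply/eqP; nia.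
case: f => // -[c] f.
rewrite forest_ok_Node forest_internal_Node forest_edges_Node.
have le_ie := forest_internal_le_edges (c ++ f).
case/and4P=> /eqP[sf] /andP[dc okf] /eqP iE /eqP eE.
rewrite -graft_size_cat forestsS mem_cat.
have [c0|c_gt0] := posnP (size c).
  rewrite c0 /= in iE eE *; apply/orP; left; apply: map_f.
  rewrite IH; last by lia.
  by rewrite (@size_cat otree); apply/and4P; split => //; apply/eqP; lia.
rewrite c_gt0 /= in dc iE.
case: m => [|m] in vE iE eE *; first by lia.
have /dvdnP[j cE] : D %| size c - 1 by rewrite -eqn_mod_dvd.
have {}cE : size c = 1 + j * D by lia.
(* By [le_ie] the other [m] internal nodes take at least [m] edges, which leaves at most [D * s] for
   [j * D]. *)
have le_js : j <= s by rewrite -(leq_pmul2l D0); lia.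
apply/orP; right; apply/allpairsPdep; exists j, (c ++ f); split.
- by rewrite mem_iota; lia.
- rewrite IH; last by nia.
  by rewrite (@size_cat otree); apply/and4P; split => //; apply/eqP; nia.
- by rewrite cE.
Qed.

Lemma forests_uniq D v r m s : 0 < D -> v = r + m + D * s ->
  uniq (forests D v r m s).
Proof.
move=> D0; elim: v r m s => [|v IH] [|r] m s // vE; rewrite forestsS.
have graft0_inj : injective (graft 0).
  by move=> f g /graft_inj[].
rewrite cat_uniq (map_inj_uniq graft0_inj).
rewrite IH; last by lia.
case: m vE => // m vE; apply/and3P; split => //.
  apply/hasPn => f /allpairsPdep[j [g [js]]].
  move: js; rewrite mem_iota => js; rewrite mem_forests //; last by nia.
  case/and4P=> /eqP sg _ _ _ ->; apply/mapP => -[h _].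
  by case/graft_inj; rewrite ?sg //; lia.
apply: (@allpairs_uniq_dep _ (fun=> seq otree)); first exact: iota_uniq.
  by move=> j; rewrite mem_iota => js; apply: IH; nia.
move=> _ _ /allpairsPdep[i [f [si fi ->]]] /allpairsPdep[j [g [sj gj ->]]] /=.
move: si sj fi gj; rewrite !mem_iota => si sj.
rewrite !mem_forests //; try by nia.
case/and4P=> /eqP sf _ _ _ /and4P[/eqP sg _ _ _].
case/graft_inj; rewrite ?sf ?sg; [by lia|by lia|].
by move=> /addnI/eqP; rewrite eqn_pmul2r // => /eqP -> ->.
Qed.

(** * Binomial sums over weak compositions *)

Lemma hockey_stick m s : \sum_(j < s.+1) 'C(m + j, j) = 'C(m.+1 + s, s).
Proof.
elim: s => [|s IH]; first by rewrite big_ord1 !bin0.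
by rewrite big_ord_recr /= IH [in RHS]addnS binS addSnnS addnC.
Qed.

(* Truncated subtraction gives [0 ^ s] at [m = 0], the correct number of ways
   to write [s] as an ordered sum of [m] naturals. *)
Definition weak_comps (m s : nat) : nat := 'C(s + m - 1, s).

(** The index [j] is the value of the first of [m.+1] parts. *)
Lemma sum_weak_comps m s :
  \sum_(j < s.+1) weak_comps m (s - j) = weak_comps m.+1 s.
Proof.
rewrite (reindex_inj rev_ord_inj) /=.
rewrite (eq_bigr (fun j : 'I_s.+1 => weak_comps m j)) => [|j _]; last first.
  by rewrite subSS subKn // -ltnS.
rewrite /weak_comps addnS subn1 /=; case: m => [|m].
  rewrite big_ord_recl big1 ?addn0 ?binn ?bin0 // => j _.
  by rewrite bin_small // lift0; lia.
under eq_bigr => j _ do rewrite addnS subn1 /= [j + m]addnC.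
by rewrite hockey_stick [s + _]addnC.
Qed.

(** By symmetry all [m.+1] parts have the same total over the weak compositions of [s], and each
    composition contributes [s] altogether. *)
Lemma sum_mul_weak_comps m s :
  m.+1 * (\sum_(j < s.+1) j * weak_comps m (s - j)) = s * weak_comps m.+1 s.
Proof.
(* Raising [s] by one raises the weight [j] of every term by one, which adds [weak_comps m.+1 s]. *)
have -> : \sum_(j < s.+1) j * weak_comps m (s - j)
          = \sum_(t < s) weak_comps m.+1 t.
  elim: s => [|s IH]; first by rewrite big_ord1 big_ord0.
  rewrite big_ord_recl mul0n add0n [in RHS]big_ord_recr /= -IH.
  rewrite -sum_weak_comps -big_split.
  by apply: eq_bigr => j _ /=; rewrite /bump /= add1n subSS mulSn addnC.
case: s => [|s]; first by rewrite big_ord0 muln0.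
under eq_bigr => t _ do rewrite /weak_comps addnS subn1 /= [t + m]addnC.
rewrite hockey_stick /weak_comps addnS subn1 /= addSn.
have := mul_bin_left (m + s).+1 s; rewrite addSn [s + m]addnC => ->.
by congr (_ * _); lia.
Qed.

Lemma card_forests D v r m s : 0 < D -> v = r + m + D * s -> 0 < v ->
  v * size (forests D v r m s) = r * 'C(v, m) * weak_comps m s.
Proof.
move=> D0; elim: v r m s => // v IH [|r] m s vE _.
  by rewrite muln0.
have [v0|v_gt0] := posnP v.
  have [r0 m0 s0] : [/\ r = 0, m = 0 & s = 0] by split; nia.
  by rewrite v0 r0 m0 s0.
(* The factor [v] is common to all terms of the recursion, so the induction hypothesis applies to
   each. *)
apply/eqP; rewrite -(eqn_pmul2l v_gt0); apply/eqP.
rewrite forestsS size_cat size_map mulnCA mulnDr IH //; last by lia.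
case: m vE => [|m] vE.
  rewrite muln0 addn0 !bin0 !muln1 /weak_comps addn0.
  case: s vE => [|s] vE; last by rewrite bin_small ?muln0; lia.
  by rewrite !muln1; nia.
rewrite size_allpairs_dep sumnE big_map -/(index_iota 0 s.+1) big_mkord.
set H := \sum_(j < s.+1) j * weak_comps m (s - j).
have -> : v * \sum_(j < s.+1) size (forests D v (r.+1 + j * D) m (s - j)) =
          'C(v, m) * (r.+1 * weak_comps m.+1 s + D * H).
  rewrite -sum_weak_comps !big_distrr -big_split big_distrr /=.
  apply: eq_bigr => j _; have := ltn_ord j => js.
  by rewrite IH //; [ring | nia].
have /(congr1 (muln D)) HE := sum_mul_weak_comps m s; rewrite -/H in HE.
(* The factor [m.+1] evaluates the first moment [H] and makes both sides multiples of
   ['C(v, m) * weak_comps m.+1 s]. *)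
apply/eqP; rewrite -(eqn_pmul2l (ltn0Sn m)); apply/eqP.
have binl := mul_bin_left v m.
have -> : m.+1 * (v * (r.+1 * 'C(v.+1, m.+1) * weak_comps m.+1 s)) =
          v * r.+1 * weak_comps m.+1 s * (m.+1 * 'C(v.+1, m.+1)) by ring.
rewrite -mul_bin_diag.
have -> : m.+1 * (v.+1 * (r * 'C(v, m.+1) * weak_comps m.+1 s +
            'C(v, m) * (r.+1 * weak_comps m.+1 s + D * H))) =
          v.+1 * (r * weak_comps m.+1 s * (m.+1 * 'C(v, m.+1)) +
            'C(v, m) * (r.+1 * m.+1 * weak_comps m.+1 s + D * (m.+1 * H)))
  by ring.
rewrite binl HE (_ : v - m = r.+1 + D * s); last by lia.
by rewrite (_ : v = r + m.+1 + D * s); [ring | lia].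
Qed.

(** * Transfer to [Nd] and to sets of trees *)

Lemma binzE (a k : nat) : k <= a -> binz a%:Z k = 'C(a, k)%:R%R.
Proof.
move=> le_ka; rewrite /binz.
have -> : (\prod_(i < k) (a%:Z - i%:Z)%:~R = (a ^_ k)%:R :> rat)%R.
  rewrite ffact_prod natr_prod; apply: eq_bigr => i _.
  by rewrite natrB ?rmorphB //; apply: ltnW; apply: leq_trans le_ka.
by rewrite -bin_ffact natrM mulfK // Num.Theory.pnatr_eq0 -lt0n fact_gt0.
Qed.

Lemma seq_card_eq (T : eqType) (s : seq T) : 
  uniq s -> ([set` s]%classic #= `I_(size s))%card.
Proof.
move=> us; apply/card_set_bijP; exists (index^~ s); split.
- by move=> x /=; rewrite index_mem.
- by move=> x y /set_mem /= xs /set_mem /= ys; apply: index_inj.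
- move=> i /= lti; case: s us lti => // x0 s us lti.
  by exists (nth x0 (x0 :: s) i); [apply: mem_nth | apply: index_uniq].
Qed.

Local Open Scope classical_set_scope.
Local Open Scope card_scope.
Local Open Scope ring_scope.

Theorem theorem3p2 (d n k : nat) (hd : (2 <= d)%N) :
  exists2 m : nat,
    [set t : otree |
      [/\ Td d t,
          (num_edges t)%:Z = (n%:Z - k%:Z) * (d%:Z - 1) + k%:Z + 1
        & num_internal t = k.+1]] #= `I_m
    & Nd d n k = m%:R.
Proof.
have tree1 t :
    [/\ forest_ok (d - 1) [:: t] = all (degree_ok (d - 1)) (vertices t),
        forest_internal [:: t] = num_internal t
      & forest_edges [:: t] = num_edges t].
  rewrite /forest_ok /forest_internal /forest_vertices /forest_edges /=.
  by rewrite cats0 addn0.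
have [le_kn|lt_nk] := leqP k n; last first.
  exists 0%N; last by rewrite /Nd bin_small ?mulr0 ?mul0r.
  (* Now [(n - k) * (d - 1) <= -1] leaves at most [k] edges for [k.+1] internal nodes. *)
  rewrite II0 card_eq0; apply/eqP/seteqP; split => // t [_ tE tI].
  have [_ iE eE] := tree1 t.
  by have := forest_internal_le_edges [:: t]; rewrite iE eE; nia.
pose s := (n - k)%N; pose v := (1 + k.+1 + (d - 1) * s)%N.
pose F := forests (d - 1) v 1 k.+1 s.
have D0 : (0 < d - 1)%N by lia.
have memF t : reflect [/\ Td d t,
          (num_edges t)%:Z = (n%:Z - k%:Z) * (d%:Z - 1) + k%:Z + 1
        & num_internal t = k.+1] ([:: t] \in F).
  have [okE iE eE] := tree1 t.
  rewrite mem_forests // okE iE eE eqxx /=.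
  apply: (iffP and3P) => [[okt /eqP it /eqP et]|[/andP[_ okt] et it]].
    split=> //; last by rewrite et; nia.
    by rewrite /Td okt andbT has_count -/(num_internal t) it.
  by split=> //; apply/eqP => //; nia.
exists (size F).
  (* Members of [F] are singletons, so the default of [head] never occurs and [head] is injective on
     [F]. *)
  rewrite (_ : mkset _ = [set` map (head (Node [::])) F]).
    rewrite -(size_map (head (Node [::]))); apply: seq_card_eq.
    rewrite map_inj_in_uniq ?forests_uniq // => f g.
    rewrite !mem_forests // => /andP[/eqP sf _] /andP[/eqP sg _].
    by case: f g sf sg => [|x [|? ?]] // [|y [|? ?]] //= _ _ ->.
  apply/seteqP; split => t /=.
    by move=> /memF tF; apply/mapP; exists [:: t].
  move=> /mapP[f fF ->]; apply/memF; move: (fF).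
  rewrite mem_forests // => /andP[/eqP sf _].
  by case: f sf fF => [|x [|? ?]].
have := @card_forests (d - 1) v 1 k.+1 s D0 erefl isT.
rewrite -/F mul1n /weak_comps (_ : s + k.+1 - 1 = n)%N; last by lia.
rewrite (_ : 'C(n, s) = 'C(n, k)) => [FE|]; last exact: bin_sub.
(* The number of edges [u = v - 1] is also the upper argument of the second binomial in [Nd]; as
   [k <= u], that binomial is an ordinary one. *)
rewrite /Nd; pose u := (k.+1 + (d - 1) * s)%N.
have {}FE : (u.+1 * size F = 'C(u.+1, k.+1) * 'C(n, k))%N := FE.
rewrite (_ : n%:Z + _ + 1 = u%:Z); last by rewrite /u /s; nia.
rewrite binzE; last by rewrite /u; lia.
have natE : ('C(n.+1, k.+1) * 'C(u, k) = n.+1 * size F)%N.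
  (* With these factors, absorption turns ['C(n.+1, k.+1)] into ['C(n, k)] and ['C(u, k)] into
     ['C(u.+1, k.+1)], as in [FE]. *)
  apply/eqP; rewrite -(eqn_pmul2l (ltn0Sn k)) -(eqn_pmul2l (ltn0Sn u)).
  apply/eqP; rewrite [RHS](_ : _ = k.+1 * n.+1 * (u.+1 * size F))%N; last by ring.
  rewrite FE.
  rewrite [LHS](_ : _ = u.+1 * 'C(u, k) * (k.+1 * 'C(n.+1, k.+1)))%N; last by ring.
  by rewrite -(mul_bin_diag n.+1) (mul_bin_diag u.+1) /=; ring.
by rewrite -mulrA -natrM natE natrM mulKf // Num.Theory.pnatr_eq0.
Qed.
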